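(* Let $n\geq 0$ be an integer. There is a one-to-one correspondence (a bijection of sets) $$\mathbb{P}^n_{\mathrm{trop}}\longrightarrow \Delta^n$$ between the tropical projective space $\mathbb{P}^n_{\mathrm{trop}}$, i.e. the set of all lines in $(\mathbb{R}^{\mathrm{trop}})^{n+1}$ through the origin, and the standard $n$-simplex $$\Delta^n=\Big\{(x_1,\ldots,x_{n+1})\in\mathbb{R}^{n+1} : x_i\geq 0 \text{ for all } i,\ \sum_{i=1}^{n+1} x_i=1\Big\}.$$
   Context: $\mathbb{R}^{\mathrm{trop}}=\mathbb{R}\sqcup\{\infty\}$. The additive group $(\mathbb{R},+)$ acts on $\mathbb{R}^{\mathrm{trop}}$ by $(r,t)\mapsto r+t$ for $t\in\mathbb{R}$ and $(r,\infty)\mapsto\infty$, and acts componentwise on $(\mathbb{R}^{\mathrm{trop}})^{n+1}$. The origin of $(\mathbb{R}^{\mathrm{trop}})^{n+1}$ is the point $(\infty,\ldots,\infty)$. A line through the origin in $(\mathbb{R}^{\mathrm{trop}})^{n+1}$ is determined by a point different from the origin: it is the orbit of that point under the action of $\mathbb{R}$ (the origin being regarded as a limit point of the line). Thus $\mathbb{P}^n_{\mathrm{trop}}$ is the set of $\mathbb{R}$-orbits in $(\mathbb{R}^{\mathrm{trop}})^{n+1}\setminus\{(\infty,\ldots,\infty)\}$. Equivalently, let $\mathbb{R}_{\geqslant}=[0,\infty)$. The bijection $f:\mathbb{R}_{\geqslant}\to\mathbb{R}^{\mathrm{trop}}$, $f(x)=-\ln x$ for $x>0$ and $f(0)=\infty$,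 applied componentwise, identifies $(\mathbb{R}^{\mathrm{trop}})^{n+1}$ with $\mathbb{R}_{\geqslant}^{n+1}$, the origin with $(0,\ldots,0)$, and the action of $r\in\mathbb{R}$ with multiplication by $e^{-r}$. *)

(* Defs.v *)
From mathcomp Require Import all_boot all_order all_algebra.
From mathcomp Require Import boolp classical_sets functions reals.

Set Implicit Arguments.
Unset Strict Implicit.
Unset Printing Implicit Defensive.

Import Order.TTheory GRing.Theory Num.Theory.

Local Open Scope classical_set_scope.
Local Open Scope ring_scope.

(* R together with one extra point: [Some t] is the real number t and [None]
   is the point at infinity. *)
Definition Rtrop (R : realType) : Type := option R.

Definition trop_act (R : realType) (r : R) (t : Rtrop R) : Rtrop R :=
  omap (fun s => r + s) t.

Definition trop_origin (R : realType) (m : nat) : 'rV[Rtrop R]_m :=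
  const_mx None.

Definition trop_orbit (R : realType) (m : nat) (p : 'rV[Rtrop R]_m) :
    set 'rV[Rtrop R]_m :=
  [set map_mx (trop_act r) p | r in [set: R]].

(* A line through the origin is represented by its orbit; the origin, being
   only a limit point of the line, does not belong to this set. *)
Definition trop_proj (R : realType) (n : nat) : set (set 'rV[Rtrop R]_n.+1) :=
  [set trop_orbit p | p in [set p | p <> trop_origin R n.+1]].

Definition std_simplex (R : realType) (n : nat) : set 'rV[R]_n.+1 :=
  [set x | (forall i, 0 <= x ord0 i) /\ \sum_(i < n.+1) x ord0 i = 1].

Arguments trop_proj : clear implicits.
Arguments std_simplex : clear implicits.

(* Main.v *)
Require Import Defs.
From mathcomp Require Import all_boot all_order all_algebra.
From mathcomp Require Import boolp classical_sets functions reals.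
From mathcomp Require Import sequences exp.

(** The map [p |-> (exp (- p_i) / \sum_j exp (- p_j))_i] is invariant under
    the action of the reals. Applying [- ln] to the image of [p] gives back [p]
    translated by [ln (\sum_j exp (- p_j))], a point of the same line; so the
    line is recovered from its image in the simplex. *)

Import Order.TTheory GRing.Theory Num.Theory.

Local Open Scope classical_set_scope.
Local Open Scope ring_scope.

Definition trop_exp {R : realType} (t : Rtrop R) : R :=
  if t is Some s then expR (- s) else 0.

(** The zero test matters: [ln 0] is 0 by convention, so without it 0 would go to the real number 0
    instead of the point at infinity. *)
Definition trop_ln {R : realType} (x : R) : Rtrop R :=
  if x == 0 then None else Some (- ln x).

Definition trop_mass {R : realType} {m : nat} (p : 'rV[Rtrop R]_m) : R :=
  \sum_i trop_exp (p ord0 i).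

Definition trop_normalize {R : realType} {m : nat} (p : 'rV[Rtrop R]_m) :
    'rV[R]_m :=
  \row_i (trop_exp (p ord0 i) / trop_mass p).

Lemma trop_exp_ge0 {R : realType} (t : Rtrop R) : 0 <= trop_exp t.
Proof. by case: t => [s|] //=; exact: expR_ge0. Qed.

Lemma trop_exp_act {R : realType} (r : R) (t : Rtrop R) :
  trop_exp (trop_act r t) = expR (- r) * trop_exp t.
Proof. by case: t => [s|] /=; rewrite ?mulr0// opprD expRD. Qed.

Lemma trop_lnK {R : realType} {x : R} : 0 <= x -> trop_exp (trop_ln x) = x.
Proof.
rewrite /trop_ln => x_ge0; case: (eqVneq x 0) => [->//|x0] /=.
by rewrite opprK lnK// posrE lt_def x0.
Qed.

(** Scaling is translation in logarithmic coordinates: [- ln (expR (- u) / s) = u + ln s]. At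
    infinity both sides stay infinite since [0 / s = 0]. *)
Lemma trop_ln_exp_div {R : realType} (s : R) (t : Rtrop R) : 0 < s ->
  trop_ln (trop_exp t / s) = trop_act (ln s) t.
Proof.
move=> s0; rewrite /trop_ln; case: t => [u|] /=; last by rewrite mul0r eqxx.
rewrite mulf_eq0 invr_eq0 (gt_eqF s0) (gt_eqF (expR_gt0 _)) /=.
by rewrite ln_div ?posrE ?expR_gt0// expRK opprB opprK.
Qed.

Lemma trop_mass_act {R : realType} {m : nat} (r : R) (p : 'rV[Rtrop R]_m) :
  trop_mass (map_mx (trop_act r) p) = expR (- r) * trop_mass p.
Proof.
by rewrite /trop_mass mulr_sumr; apply: eq_bigr => i _; rewrite mxE trop_exp_act.
Qed.

(** A sum of nonnegative terms vanishes only if every term does, and [trop_exp] vanishes only at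
    infinity. *)
Lemma trop_mass_gt0 {R : realType} {m : nat} (p : 'rV[Rtrop R]_m) :
  p <> trop_origin R m -> 0 < trop_mass p.
Proof.
move=> p0; rewrite lt_neqAle sumr_ge0 ?andbT => [|i _]; last exact: trop_exp_ge0.
apply/eqP => /esym/eqP; rewrite psumr_eq0 => [/allP mass0|i _]; last first.
  exact: trop_exp_ge0.
apply: p0; apply/rowP => i; rewrite mxE.
have := mass0 i (mem_index_enum i).
by case: (p ord0 i) => [s|] //=; rewrite (gt_eqF (expR_gt0 _)).
Qed.

(** The factor [expR (- r)] appears in both the numerator and the mass, and cancels. *)
Lemma trop_normalize_act {R : realType} {m : nat} (r : R)
    (p : 'rV[Rtrop R]_m) :
  trop_normalize (map_mx (trop_act r) p) = trop_normalize p.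
Proof.
apply/rowP => i; rewrite !mxE trop_mass_act trop_exp_act.
by rewrite -mulf_div divff ?mul1r// gt_eqF ?expR_gt0.
Qed.

Lemma trop_normalize_simplex {R : realType} {n : nat}
    (p : 'rV[Rtrop R]_n.+1) :
  p <> trop_origin R n.+1 -> std_simplex R n (trop_normalize p).
Proof.
move=> /trop_mass_gt0 s0; split=> [i|].
  by rewrite mxE divr_ge0 ?trop_exp_ge0// ltW.
under eq_bigr do rewrite mxE.
by rewrite -mulr_suml divff// gt_eqF.
Qed.

Lemma trop_act0 {R : realType} (t : Rtrop R) : trop_act 0 t = t.
Proof. by case: t => [s|] //=; rewrite add0r. Qed.

Lemma trop_actD {R : realType} (r s : R) (t : Rtrop R) :
  trop_act r (trop_act s t) = trop_act (r + s) t.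
Proof. by case: t => [u|] //=; rewrite addrA. Qed.

Lemma trop_orbit_refl {R : realType} {m : nat} (p : 'rV[Rtrop R]_m) :
  trop_orbit p p.
Proof. by exists 0 => //; apply/rowP => i; rewrite mxE trop_act0. Qed.

Lemma trop_orbit_act {R : realType} {m : nat} (r : R) (p : 'rV[Rtrop R]_m) :
  trop_orbit (map_mx (trop_act r) p) = trop_orbit p.
Proof.
apply/seteqP; split=> _ [s _ <-].
  by exists (s + r) => //; apply/rowP => i; rewrite !mxE trop_actD.
by exists (s - r) => //; apply/rowP => i; rewrite !mxE trop_actD subrK.
Qed.

Lemma trop_orbit_ln_normalize {R : realType} {m : nat} (p : 'rV[Rtrop R]_m) :
  p <> trop_origin R m ->
  trop_orbit (map_mx trop_ln (trop_normalize p)) = trop_orbit p.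
Proof.
move=> /trop_mass_gt0 s0; rewrite -(trop_orbit_act (ln (trop_mass p)) p).
by congr trop_orbit; apply/rowP => i; rewrite !mxE trop_ln_exp_div.
Qed.

(** The logarithmic lift of a point of the simplex already has mass 1, so normalizing only applies
    [trop_exp]. This gives surjectivity. *)
Lemma trop_ln_normalizeK {R : realType} {n : nat} (x : 'rV[R]_n.+1) :
  std_simplex R n x -> trop_normalize (map_mx trop_ln x) = x.
Proof.
move=> [x0 x1].
have mass1 : trop_mass (map_mx trop_ln x) = 1.
  by rewrite -x1; apply: eq_bigr => i _; rewrite mxE trop_lnK.
by apply/rowP => i; rewrite mxE mass1 divr1 mxE trop_lnK.
Qed.

(** If all the logarithms were infinite, all coordinates of [x] would be 0 and could not sum to
    1. *)
Lemma trop_ln_neq_origin {R : realType} {n : nat} (x : 'rV[R]_n.+1) :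
  std_simplex R n x -> map_mx trop_ln x <> trop_origin R n.+1.
Proof.
move=> [x0 x1] /rowP xE; move/eqP: x1; rewrite big1 ?(eq_sym 0) ?oner_eq0//.
by move=> i _; rewrite -(trop_lnK (x0 i)); have := xE i; rewrite !mxE => ->.
Qed.

Theorem lemma2p4 (R : realType) (n : nat) :
  exists f : set 'rV[Rtrop R]_n.+1 -> 'rV[R]_n.+1,
    set_bij (trop_proj R n) (std_simplex R n) f.
Proof.
(* Normalize an arbitrarily chosen point of the line; the origin is only the default value for an
   empty set. *)
pose f (A : set 'rV[Rtrop R]_n.+1) :=
  trop_normalize (xget (trop_origin R n.+1) A).
have fE p : f (trop_orbit p) = trop_normalize p.
  (* The chosen point is a translate of [p], hence has the same normalization; the default case is
     excluded because the orbit contains [p]. *)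
  rewrite /f; case: xgetP => [_ _ [r _ <-]|/(_ p) []].
    exact: trop_normalize_act.
  exact: trop_orbit_refl.
exists f; split.
- by move=> _ [p p0 <-]; rewrite fE; exact: trop_normalize_simplex.
- move=> _ _ /set_mem[p p0 <-] /set_mem[q q0 <-]; rewrite !fE => pq.
  (* Both lines are the orbit of the logarithm of the same normalized point. *)
  by rewrite -trop_orbit_ln_normalize// pq trop_orbit_ln_normalize.
- move=> x xS; exists (trop_orbit (map_mx trop_ln x)).
    by exists (map_mx trop_ln x) => //; exact: trop_ln_neq_origin.
  by rewrite fE trop_ln_normalizeK.
Qed.
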